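(* Let $p\ge 3$ be a prime, and let $t$ be an integer with $1\le t\le p-1$. Then for all integers $n\ge0$ and $k\ge j\ge0$: \begin{enumerate} \item if $t$ is a quadratic non-residue modulo $p$, then \[ \bar{a}_{p(k-j)+(p-1),\, pk+(p+1)} (pn+t)\equiv 0\pmod {p}; \] \item if $2^{-1}t$ (inverse taken modulo $p$) is a quadratic non-residue modulo $p$, then \[ \bar{a}_{p(k-j)+(p-1),\, pk+p} (pn+t)\equiv 0\pmod {p}. \] \end{enumerate}
   Context: For $m\ge1$ let $f_m:=\prod_{k=1}^{\infty}(1-q^{mk})$. For integers $r,s\ge1$, $\bar{a}_{r,s}(n)$ denotes the number of overpartitions of $n$ (partitions in which the first occurrence of each part size may be overlined) wherein each even part may appear in one of $r$ colors and each odd part in one of $s$ colors; its generating function is \[ \sum_{n=0}^{\infty}\bar{a}_{r,s}(n)q^n=\frac{f_2^{3s-2r}}{f_1^{2s}f_4^{s-r}}. \] *)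

(* Defs.v *)
From HB Require Import structures.
From mathcomp Require Import all_boot all_algebra.

Set Implicit Arguments.
Unset Strict Implicit.
Unset Printing Implicit Defensive.

Import GRing.Theory.

(* r colors for even part sizes, s colors for odd ones *)
Definition num_colors (r s m : nat) : nat := if odd m then s else r.

(* Colored parts of size at most n: the index i : 'I_n stands for the part
   size i.+1, and is paired with a color available for that size. *)
Definition colored_part (r s n : nat) : finType :=
  {i : 'I_n & 'I_(num_colors r s i.+1)}.

Definition part_size (r s n : nat) (x : colored_part r s n) : nat :=
  (tag x).+1.

(* An overpartition of n is encoded by the map sending each colored part to its
   multiplicity and a flag telling whether its first occurrence is overlined
   (a given size in two different colors counts as two different parts, each
   with its own overline).  Neither a part size nor a multiplicity can exceed
   n, so the bounds in the types lose nothing. *)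
Definition overpartition_data (r s n : nat) : finType :=
  {ffun colored_part r s n -> 'I_n.+1 * bool}.

Definition is_overpartition (r s n : nat) (f : overpartition_data r s n) : bool :=
  (\sum_(x : colored_part r s n) (f x).1 * part_size x == n)
  && [forall x, (f x).2 ==> (0 < (f x).1)].

Definition abar (r s n : nat) : nat :=
  #|[set f : overpartition_data r s n | is_overpartition f]|.

Definition quadratic_nonresidue (p : nat) (a : 'F_p) : Prop :=
  (a != 0 /\ ~ exists x : 'F_p, x ^+ 2 = a)%R.

(* Main.v *)
(* Put e_m = (1 + q^m) / (1 - q^m), so that abar_{r,s} has generating function
   prod_{m even} e_m^r prod_{m odd} e_m^s.  Over F_p, and up to a p-th power
   (whose coefficients vanish off the multiples of p), this product reduces in
   case 1 to prod_{m even} e_m^-1 prod_{m odd} e_m and in case 2 to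
   prod_{m even} e_m^-1.  By Gauss's identity
     prod_m (1 - q^m) / (1 + q^m) = sum_{s in Z} (-1)^s q^(s^2),
   taken at -q and at q^2, these are supported on the exponents s^2 and 2 s^2
   respectively.  Gauss's identity is obtained modulo q^(n+1) from Shanks' finite
   form of it, and all series are replaced by polynomials modulo X^(N+1). *)
Require Import Defs.
From HB Require Import structures.
From mathcomp Require Import all_boot all_algebra.
From mathcomp Require Import ring zify.

Set Implicit Arguments.
Unset Strict Implicit.
Unset Printing Implicit Defensive.

Import GRing.Theory.
Local Open Scope ring_scope.

(** * Gauss's identity in finite form *)

Section GaussSquares.
Variables (R : comNzRingType) (q : R).

(** Partial sum of sum_{s in Z} (-1)^s q^(s^2), with s and -s paired. *)
Definition theta (n : nat) : R :=
  1 + 2%:R * \sum_(1 <= s < n.+1) (-1) ^+ s * q ^+ (s ^ 2).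

(** Cofactor of q^(s(n+1)) in Shanks' identity, with denominators cleared. *)
Let T (s n : nat) : R :=
  \prod_(s.+1 <= i < n.+1) (1 - q ^+ i) * \prod_(1 <= i < s) (1 + q ^+ i).

(* The differences in [T_rec] are sums of consecutive [G], which telescope
   against the alternating sign. *)
Let G (s n : nat) : R :=
  q ^+ (s * n.+1) * \prod_(s <= i < n.+1) (1 - q ^+ i)
    * \prod_(1 <= i < s) (1 + q ^+ i).

Let T_rec (s n : nat) : (0 < s <= n)%N ->
  q ^+ (s * n.+2) * T s n.+1 =
  (1 + q ^+ n.+1) * (q ^+ (s * n.+1) * T s n) - (G s n + G s.+1 n).
Proof.
case/andP=> s_gt0 le_sn; rewrite /T /G.
rewrite (big_nat_recr n.+1) //= (big_ltn (n := n.+1) (m := s)) //.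
rewrite [\prod_(1 <= i < s.+1) _]big_nat_recr //=.
rewrite [(s * n.+2)%N]mulnS [(s.+1 * _)%N]mulSn !exprD.
ring.
Qed.

Let telescope_G (n m : nat) : (m <= n)%N ->
  \sum_(1 <= s < m.+1) (-1) ^+ s * (G s n + G s.+1 n)
    = (-1) ^+ m * G m.+1 n - G 1 n.
Proof.
elim: m => [|m IHm] lt_mn; first by rewrite big_nil expr0; ring.
by rewrite big_nat_recr //= IHm 1?ltnW // exprS; ring.
Qed.

(* Shanks' identity: every term of the last sum is divisible by [q ^+ n.+1]. *)
Let theta_expansion (n : nat) :
  theta n * \prod_(1 <= i < n.+1) (1 + q ^+ i) =
  \prod_(1 <= i < n.+1) (1 - q ^+ i)
    + 2%:R * \sum_(1 <= s < n.+1) (-1) ^+ s * (q ^+ (s * n.+1) * T s n).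
Proof.
elim: n => [|n IHn]; first by rewrite /theta !big_nil; ring.
have -> : theta n.+1 = theta n + 2%:R * ((-1) ^+ n.+1 * q ^+ (n.+1 ^ 2)).
  by rewrite /theta big_nat_recr //=; ring.
rewrite (big_nat_recr n.+1) //= mulrDl mulrA IHn.
rewrite (big_nat_recr n.+1) //= [\sum_(1 <= s < n.+2) _]big_nat_recr //=.
have -> : \sum_(1 <= s < n.+1) (-1) ^+ s * (q ^+ (s * n.+2) * T s n.+1)
  = (1 + q ^+ n.+1)
      * (\sum_(1 <= s < n.+1) (-1) ^+ s * (q ^+ (s * n.+1) * T s n))
    - \sum_(1 <= s < n.+1) (-1) ^+ s * (G s n + G s.+1 n).
  rewrite big_distrr -sumrB; apply: eq_big_nat => s s_range.
  by rewrite T_rec //=; ring.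
(* The boundary term [G 1 n] turns 1 - q^(n+1) into 1 + q^(n+1); the other one, with the summand s =
   n+1, yields the new term of [theta]. *)
rewrite telescope_G // /G /T mul1n.
rewrite !(big_geq (m := n.+2)) // !(big_geq (m := n.+1) (n := n.+1)) //.
rewrite (big_geq (m := 1) (n := 1)) // -mulnn.
rewrite [(n.+1 * n.+2)%N]mulnS !exprD [(-1) ^+ n.+1]exprS.
ring.
Qed.

Lemma gauss_squares_mod (n : nat) : exists W : R,
  theta n * \prod_(1 <= i < n.+1) (1 + q ^+ i) =
  \prod_(1 <= i < n.+1) (1 - q ^+ i) + q ^+ n.+1 * W.
Proof.
exists (2%:R * \sum_(1 <= s < n.+1)
          (-1) ^+ s * (q ^+ (s.-1 * n.+1) * T s n)).
rewrite theta_expansion; congr (_ + _).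
rewrite [RHS]mulrCA [in RHS]big_distrr /=; congr (_ * _).
apply: eq_big_nat => -[|s] //= _.
by rewrite mulSn exprD; ring.
Qed.

End GaussSquares.

(** * Power series modulo X^(N+1) *)

Section PowerSeriesModulo.
Variables (F : fieldType) (N : nat).
Implicit Types a b c d : {poly F}.

Definition eqX a b := 'X^(N.+1) %| a - b.

Lemma eqX_refl a : eqX a a.
Proof. by rewrite /eqX subrr dvdp0. Qed.

Lemma eqX_sym a b : eqX a b -> eqX b a.
Proof. by rewrite /eqX -opprB dvdpNr. Qed.

Lemma eqX_trans b a c : eqX a b -> eqX b c -> eqX a c.
Proof. by move=> ab bc; rewrite /eqX -(subrKA b) dvdp_add. Qed.

Lemma eqX_mul a b c d : eqX a b -> eqX c d -> eqX (a * c) (b * d).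
Proof.
move=> ab cd; rewrite /eqX.
have -> : a * c - b * d = c * (a - b) + b * (c - d) by ring.
by rewrite dvdp_add ?dvdp_mull.
Qed.

Lemma eqX_prod (I : eqType) (r : seq I) (f g : I -> {poly F}) :
  {in r, forall i, eqX (f i) (g i)} ->
  eqX (\prod_(i <- r) f i) (\prod_(i <- r) g i).
Proof.
move=> fg; rewrite !big_seq.
by elim/big_ind2: _ => //; [exact: eqX_refl | move=> *; exact: eqX_mul].
Qed.

Lemma eqX_coef a b : eqX a b -> a`_N = b`_N.
Proof.
case/dvdpP=> w /eqP; rewrite subr_eq => /eqP ->.
by rewrite coefD coefMXn ltnSn add0r.
Qed.

(** A nonzero constant term makes [d] coprime to X, hence to X^(N+1). *)
Lemma eqX_cancel d a b : d.[0] != 0 -> eqX (a * d) (b * d) -> eqX a b.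
Proof.
move=> d0; rewrite /eqX -mulrBl Gauss_dvdpl // coprimep_expl //.
by rewrite coprimep_sym -['X]subr0 -polyC0 coprimep_XsubC.
Qed.

Lemma eqX_addX a b n : (N < n)%N -> eqX (a + 'X^n * b) a.
Proof.
by move=> ltNn; rewrite /eqX addrAC subrr add0r dvdp_mulr ?dvdp_exp2l.
Qed.

(* [(1 + X^m) / (1 - X^m)] up to degree [N * m] *)
Definition part_gf (m : nat) : {poly F} :=
  \sum_(i < N.+1) (if i == 0%N :> nat then 1 else 2%:R) * 'X^(i * m).

Lemma part_gfE (m : nat) : (0 < m)%N ->
  eqX (part_gf m * (1 - 'X^m)) (1 + 'X^m).
Proof.
(* The product telescopes up to a tail whose exponent exceeds N. *)
move=> m_gt0; have -> : part_gf m * (1 - 'X^m) =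
  1 + 'X^m + 'X^(N.+1 * m) * (- 2%:R).
  rewrite /part_gf; elim: N => [|k IHk].
    by rewrite big_ord1 mul1n mul0n expr0 /=; ring.
  by rewrite big_ord_recr /= mulrDl IHk [in RHS]mulSn exprD; ring.
by apply: eqX_addX; rewrite -[X in (X <= _)%N]muln1 leq_mul.
Qed.

End PowerSeriesModulo.

(** * Generating function of [abar] *)

Lemma abar_coef (F : fieldType) (r s N : nat) :
  (abar r s N)%:R =
  (\prod_(1 <= m < N.+1) part_gf F N m ^+ num_colors r s m)`_N.
Proof.
have -> : \prod_(1 <= m < N.+1) part_gf F N m ^+ num_colors r s m =
  \prod_(x : colored_part r s N) part_gf F N (part_size x).
  rewrite big_add1 /= big_mkord.
  rewrite (eq_bigr (fun i : 'I_N =>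
    \prod_(c < num_colors r s i.+1) part_gf F N i.+1)); last first.
    by move=> i _; rewrite prodr_const card_ord.
  by rewrite sig_big_dep.
(* The coefficient 2 counts the two flags of a positive multiplicity; multiplicity 0 admits only
   [false]. Expanding the product then selects a multiplicity and a flag for each colored part. *)
have gfE m : part_gf F N m =
  \sum_(u : 'I_N.+1 * bool) ((u.2 ==> (0 < u.1)%N)%:R * 'X^(u.1 * m)).
  rewrite -(pair_bigA _ (fun (i : 'I_N.+1) (b : bool) =>
    ((b ==> (0 < i)%N)%:R * 'X^(i * m) : {poly F}))) /=.
  apply: eq_bigr => i _; rewrite big_bool /= lt0n.
  by case: eqP => _ /=; ring.
rewrite (eq_bigr _ (fun x _ => gfE (part_size x))) bigA_distr_bigA /=.
rewrite coef_sum /abar -sum1_card natr_sum big_mkcond /=.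
apply: eq_bigr => f _; rewrite inE /is_overpartition.
rewrite big_split /= -expr_sum.
have -> : \prod_(x : colored_part r s N) ((f x).2 ==> (0 < (f x).1)%N)%:R
  = ([forall x, (f x).2 ==> (0 < (f x).1)%N])%:R :> {poly F}.
  case: forallP => [ok | nok].
    by rewrite big1 // => x _; rewrite ok.
  have /forallPn[x /negbTE bad] : ~~ [forall x, (f x).2 ==> (0 < (f x).1)%N].
    by apply/forallP.
  by rewrite (bigD1 x) //= bad mul0r.
rewrite mulr_natl coefMn coefXn eq_sym.
by case: eqP; case: forallP.
Qed.

(** * Coefficients in characteristic p *)

Lemma coef_Frobenius (F : fieldType) (p : nat) (H : {poly F}) (i : nat) :
  p \in [pchar F] -> (H ^+ p)`_i != 0 -> (p %| i)%N.
Proof.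
move=> pcharF; have pcharP : p \in [pchar {poly F}] by rewrite pchar_poly.
rewrite -(pFrobenius_autE pcharP) -[H]coefK poly_def raddf_sum coef_sum.
apply: contraR => ndvd; apply/eqP/big1 => k _.
rewrite /= pFrobenius_autE exprZn -exprM coefZ coefXn.
case: eqP => [def_i | _]; last exact: mulr0.
by rewrite def_i dvdn_mull in ndvd.
Qed.

Lemma coef_theta (F : fieldType) (a : F) (c n i : nat) :
  (forall s, i <> c * s ^ 2)%N -> (theta (a *: 'X^c) n)`_i = 0.
Proof.
move=> no_s; have coef_pow s : ((a *: 'X^c) ^+ (s ^ 2))`_i = 0.
  rewrite exprZn -exprM coefZ coefXn.
  by case: eqP => [/no_s|_] //; exact: mulr0.
rewrite coefD -[1]/((a *: 'X^c) ^+ (0 ^ 2)) coef_pow add0r mulr_natl coefMn.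
rewrite coef_sum big1 ?mul0rn // => s _.
by rewrite -signr_odd mulr_sign; case: ifP; rewrite ?coefN coef_pow ?oppr0.
Qed.

(** A nonzero term of the convolution would need p | i and N - i = c s^2, hence N = c s^2 in F_p. *)
Lemma coef_Frobenius_theta (p : nat) (a : 'F_p) (H : {poly 'F_p})
    (c n N : nat) :
  prime p -> (forall x : 'F_p, N%:R <> c%:R * x ^+ 2) ->
  (H ^+ p * theta (a *: 'X^c) n)`_N = 0.
Proof.
move=> p_prime no_x; have pcharFp := pchar_Fp p_prime.
rewrite coefM big1 // => i _.
have [-> | Hi_neq0] := eqVneq (H ^+ p)`_i 0; first exact: mul0r.
rewrite coef_theta ?mulr0 // => s def_s; apply: (no_x s%:R).
rewrite -natrX -natrM -def_s natrB -1?ltnS //.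
have := coef_Frobenius pcharFp Hi_neq0.
by rewrite (dvdn_pcharf pcharFp) => /eqP ->; rewrite subr0.
Qed.

Lemma eqX_theta (F : fieldType) (a : F) (c n N : nat) :
  (N < c * n.+1)%N ->
  eqX N (theta (a *: 'X^c) n * \prod_(1 <= i < n.+1) (1 + (a *: 'X^c) ^+ i))
    (\prod_(1 <= i < n.+1) (1 - (a *: 'X^c) ^+ i)).
Proof.
move=> ltN; have [W ->] := gauss_squares_mod (a *: 'X^c : {poly F}) n.
by rewrite exprZn -exprM -scalerAl scalerAr; apply: eqX_addX.
Qed.

(** Division-free reduction: [v m] over [u m] is what remains of the m-th factor once [h m ^+ p] is
    split off, and [Theta] stands for the product of these quotients. *)
Lemma abar_coef_Frobenius (F : fieldType) (p r s N : nat)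
    (u v h : nat -> {poly F}) (Theta : {poly F}) :
  (forall m, (0 < m)%N ->
     eqX N (part_gf F N m ^+ num_colors r s m * u m) (h m ^+ p * v m)) ->
  (forall m, (0 < m)%N -> (u m).[0] = 1) ->
  eqX N (Theta * \prod_(1 <= m < N.+1) u m) (\prod_(1 <= m < N.+1) v m) ->
  (abar r s N)%:R = ((\prod_(1 <= m < N.+1) h m) ^+ p * Theta)`_N.
Proof.
move=> uv u0 uTheta; rewrite abar_coef; apply: eqX_coef.
apply: (@eqX_cancel _ _ (\prod_(1 <= m < N.+1) u m)).
  rewrite horner_prod big_seq big1 ?oner_neq0 // => m.
  by rewrite mem_index_iota => /andP[m_gt0 _]; apply: u0.
rewrite -big_split /= -mulrA.
apply: (@eqX_trans _ _ (\prod_(1 <= m < N.+1) (h m ^+ p * v m))).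
  apply: eqX_prod => m; rewrite mem_index_iota => /andP[m_gt0 _].
  exact: uv.
rewrite big_split /= prodrXl; apply: eqX_mul; first exact: eqX_refl.
exact: eqX_sym.
Qed.

(** * Splitting off p-th powers and the two congruences *)

Lemma part_gf_exp_even (F : fieldType) (N p l m : nat) :
  (0 < m)%N -> (0 < p)%N ->
  eqX N (part_gf F N m ^+ (p * l + (p - 1)) * (1 + 'X^m))
    ((part_gf F N m ^+ l.+1) ^+ p * (1 - 'X^m)).
Proof.
move=> m_gt0 p_gt0.
have -> : (part_gf F N m ^+ l.+1) ^+ p * (1 - 'X^m) =
    part_gf F N m ^+ (p * l + (p - 1)) * (part_gf F N m * (1 - 'X^m)).
  by rewrite mulrA -exprSr -exprM; congr (_ ^+ _ * _); lia.
by apply: eqX_mul (eqX_refl _ _) (eqX_sym (part_gfE _ _ _)).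
Qed.

Lemma part_gf_exp_odd (F : fieldType) (N p l m : nat) :
  (0 < m)%N ->
  eqX N (part_gf F N m ^+ (p * l + (p + 1)) * (1 - 'X^m))
    ((part_gf F N m ^+ l.+1) ^+ p * (1 + 'X^m)).
Proof.
move=> m_gt0.
have -> : (p * l + (p + 1) = (l.+1 * p).+1)%N by lia.
rewrite exprSr -mulrA -exprM.
by apply: eqX_mul (eqX_refl _ _) (part_gfE _ _ _).
Qed.

Lemma prod_even_parts (R : comNzRingType) (g : nat -> R) (N : nat) :
  \prod_(1 <= m < N.+1) (if odd m then 1 else g m)
    = \prod_(1 <= i < N./2.+1) g i.*2.
Proof.
elim: N => [|N IHN]; first by rewrite !big_nil.
rewrite big_nat_recr //= IHN uphalf_half; case: ifP => oddN.
  by rewrite mulr1 (negbTE oddN).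
rewrite (negbFE oddN) add1n [in RHS]big_nat_recr //=; congr (_ * g _).
by lia.
Qed.

Lemma dvdn_abar_square (p a b N : nat) :
  prime p -> (forall x : 'F_p, N%:R <> x ^+ 2) ->
  (p %| abar (p * a + (p - 1)) (p * b + (p + 1)) N)%N.
Proof.
move=> p_prime no_x; have p_gt0 := prime_gt0 p_prime.
rewrite (dvdn_pcharf (pchar_Fp p_prime)).
(* At -X, the quotient (1 - (-X)^m) / (1 + (-X)^m) is e_m for odd m and its inverse for even m. *)
rewrite (abar_coef_Frobenius (p := p)
  (h := fun m => part_gf 'F_p N m ^+ (if odd m then b.+1 else a.+1))
  (u := fun m => 1 + (-1 *: 'X^1) ^+ m) (v := fun m => 1 - (-1 *: 'X^1) ^+ m)
  (Theta := theta (-1 *: 'X^1) N)).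
- by rewrite coef_Frobenius_theta // => x; rewrite mul1r; apply: no_x.
- move=> m m_gt0; rewrite expr1 exprZn -signr_odd /num_colors.
  case: ifP => _; rewrite ?expr1 ?scaleN1r ?opprK ?expr0 ?scale1r.
    exact: part_gf_exp_odd.
  exact: part_gf_exp_even.
- by case=> // m _; rewrite !hornerE /= expr0n /= ?mulr0 ?addr0.
- by apply: eqX_theta; rewrite mul1n.
Qed.

Lemma dvdn_abar_double_square (p a b N : nat) :
  prime p -> (forall x : 'F_p, N%:R <> 2%:R * x ^+ 2) ->
  (p %| abar (p * a + (p - 1)) (p * b + p) N)%N.
Proof.
move=> p_prime no_x; have p_gt0 := prime_gt0 p_prime.
rewrite (dvdn_pcharf (pchar_Fp p_prime)).
(* Odd m contribute pure p-th powers. Even m = 2i <= N means i <= N/2, and 2(N/2 + 1) > N makes this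
   truncation of [theta] long enough. *)
rewrite (abar_coef_Frobenius (p := p)
  (h := fun m => part_gf 'F_p N m ^+ (if odd m then b.+1 else a.+1))
  (u := fun m => if odd m then 1 else 1 + 'X^m)
  (v := fun m => if odd m then 1 else 1 - 'X^m)
  (Theta := theta (1 *: 'X^2) N./2)).
- by rewrite coef_Frobenius_theta.
- move=> m m_gt0; rewrite /num_colors; case: ifP => _.
    by rewrite !mulr1 -exprM addnC -mulnS mulnC; apply: eqX_refl.
  exact: part_gf_exp_even.
- move=> m m_gt0; case: ifP => _; rewrite !hornerE //= expr0n.
  by case: m m_gt0 => //= m _; rewrite addr0.
- have pow_even i : 'X^(i.*2) = (1 *: 'X^2) ^+ i :> {poly 'F_p}.
    by rewrite scale1r -exprM mul2n.
  rewrite !prod_even_parts.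
  under eq_bigr do rewrite pow_even.
  under [X in eqX _ _ X]eq_bigr do rewrite pow_even.
  by apply: eqX_theta; lia.
Qed.

Local Close Scope ring_scope.

Theorem theorem1p8 (p t : nat) (p_prime : prime p) (p_ge3 : 3 <= p)
    (t_range : 1 <= t <= p - 1) (n k j : nat) (le_jk : j <= k) :
  (quadratic_nonresidue (t%:R : 'F_p)%R ->
     abar (p * (k - j) + (p - 1)) (p * k + (p + 1)) (p * n + t) = 0 %[mod p])
  /\
  (quadratic_nonresidue (2%:R^-1 * t%:R : 'F_p)%R ->
     abar (p * (k - j) + (p - 1)) (p * k + p) (p * n + t) = 0 %[mod p]).
Proof.
have pcharFp := pchar_Fp p_prime.
have N_t : ((p * n + t)%:R = t%:R :> 'F_p)%R.
  by rewrite natrD natrM (pcharf0 pcharFp) mul0r add0r.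
split=> -[_ nonres]; apply/eqP; rewrite mod0n -/(dvdn p _).
  apply: dvdn_abar_square => // x; rewrite N_t => def_t.
  by apply: nonres; exists x.
apply: dvdn_abar_double_square => // x; rewrite N_t => def_t.
(* Cancelling 2 in F_p is allowed since p >= 3. *)
apply: nonres; exists x; rewrite def_t mulKf //.
by rewrite -(dvdn_pcharf pcharFp) gtnNdvd.
Qed.
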